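(* Let $n>5$, and let $H:=D_{2n}$ be the dihedral subgroup of order $2n$ of the symmetric group $\mathfrak{S}_n$ with generators $a:=(1,2,\ldots,n)$ and $b:=(1,n)(2,n-1)(3,n-2)\cdots(\lfloor \frac{n}{2}\rfloor,\lceil \frac{n+2}{2}\rceil)$. Then the ring extension $\mathbb{C}H\subset \mathbb{C}\mathfrak{S}_n$ has depth $3$.
   Context: For finite groups $H\subseteq G$ let $\mathrm{Irr}(G)=\{\chi_1,\dots,\chi_s\}$ and $\mathrm{Irr}(H)=\{\psi_1,\dots,\psi_r\}$ be the irreducible complex characters; the inclusion matrix of $\mathbb{C}H\subseteq\mathbb{C}G$ is the $r\times s$ matrix $M=(m_{ij})$ with $m_{ij}=\langle \psi_i, \chi_j\!\downarrow_H\rangle$. Powers of $M$ are understood as $M^1=M$, $M^2=MM^t$, $M^3=MM^tM$, etc., and inequalities between matrices are entrywise. The matrix $M$ satisfies a depth $k$ inequality ($k\ge 2$) if $M^{k+1}\le qM^{k-1}$ for some positive integer $q$; the depth of $\mathbb{C}H\subseteq\mathbb{C}G$ is the least $k\ge 2$ for which a depth $k$ inequality holds. *)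

(* Defs.v *)
From mathcomp Require Import all_boot all_order all_algebra.
From mathcomp Require Import all_fingroup all_solvable all_field all_character.
Set Implicit Arguments.
Unset Strict Implicit.
Unset Printing Implicit Defensive.
Import Order.TTheory GRing.Theory Num.Theory.
Local Open Scope ring_scope.

(* 'chi[H]_i and 'chi[G]_j run over the irreducible complex characters (their
   values lie in algC).  Only meaningful for H \subset G. *)
Definition inclusion_mx (gT : finGroupType) (H G : {group gT}) :
    'M[algC]_(Nirr H, Nirr G) :=
  \matrix_(i, j) '['chi_i, 'Res[H] 'chi_j].

(* Alternating powers M^1 = M, M^2 = M M^T, M^3 = M M^T M, ..., with M^0 = 1.
   The width depends on the parity of k; stepping by 2 makes the types of the
   k-th and (k+2)-th powers convertible. *)
Fixpoint altpow_width (m n k : nat) : nat :=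
  match k with
  | 0 => m
  | 1 => n
  | k'.+2 => altpow_width m n k'
  end.

Fixpoint altpow_mx (R : pzSemiRingType) (m n : nat) (M : 'M[R]_(m, n))
    (k : nat) : 'M[R]_(m, altpow_width m n k) :=
  match k return 'M[R]_(m, altpow_width m n k) with
  | 0 => 1%:M
  | 1 => M
  | k'.+2 => M *m M^T *m altpow_mx M k'
  end.

(* M^(k+1) <= q M^(k-1) entrywise, with k = l + 1. *)
Definition depth_inequality (R : numDomainType) (m n : nat)
    (M : 'M[R]_(m, n)) (k : nat) : Prop :=
  if k is l.+1 then
    exists2 q : nat, (0 < q)%N &
      forall i j, altpow_mx M l.+2 i j <= q%:R * altpow_mx M l i j
  else False.

(* d is the depth of the inclusion of complex group algebras CH in CG. *)
Definition group_algebra_depth (gT : finGroupType) (H G : {group gT})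
    (d : nat) : Prop :=
  [/\ (2 <= d)%N,
      depth_inequality (inclusion_mx H G) d &
      forall k : nat, (2 <= k)%N ->
        depth_inequality (inclusion_mx H G) k -> (d <= k)%N].

(* The point i of {1, ..., n} is the element i - 1 of 'I_n: the n-cycle
   (1, 2, ..., n) is the cyclic successor ordS, and rev_ord sends i to
   n + 1 - i, so the product below is (1, n)(2, n - 1)(3, n - 2)... *)
Definition dihedral_rot (n : nat) : 'S_n := perm (@ordS_inj n).

Definition dihedral_refl (n : nat) : 'S_n :=
  (\prod_(i < n | (i < n./2)%N) tperm i (rev_ord i))%g.

Definition dihedral_subgroup (n : nat) : {group 'S_n} :=
  <<[set dihedral_rot n; dihedral_refl n]>>%G.

(* Main.v *)
(* If H :&: H :^ g = 1 for some g, the double coset of g makes every pair of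
   irreducible characters of H meet in G: M M^T is entrywise positive, which
   gives the depth 3 inequality at once.  A depth 2 inequality would then force
   M itself to be positive, but the trivial character of G restricts to the
   trivial character of H only.  For the dihedral group the 3-cycle sending
   0 to 1, 1 to 2 and 2 to 0 is such a g as soon as n > 5. *)

Require Import Defs.
From mathcomp Require Import all_boot all_order all_algebra.
From mathcomp Require Import all_fingroup all_solvable all_field all_character.
From mathcomp Require Import zify.
Set Implicit Arguments.
Unset Strict Implicit.
Unset Printing Implicit Defensive.
Import Order.TTheory GRing.Theory Num.Theory.
Local Open Scope ring_scope.

(** * Positivity of inner products with induced characters *)

Section Mackey.

Variables (gT : finGroupType) (H G : {group gT}).

(** Mackey's formula, summed over all of [G] instead of double coset representatives; [psi] vanishes
    off [H], so no intersection has to be named. *)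
Lemma cfdot_Res_Ind (phi psi : 'CF(H)) : H \subset G ->
  '[phi, 'Res[H] ('Ind[G] psi)] =
    #|H|%:R^-1 ^+ 2 * \sum_(y in G) \sum_(x in H) phi x * (psi (x ^ y)%g)^*.
Proof.
move=> sHG; rewrite cfdotE exchange_big /= expr2 -mulrA; congr (_ * _).
rewrite mulr_sumr; apply: eq_bigr => x Hx.
rewrite cfResE // cfIndE // rmorphM fmorphV rmorph_nat rmorph_sum /= mulrCA.
by congr (_ * _); rewrite mulr_sumr.
Qed.

(* The sum is #|K| times the inner product on K := H :&: H :^ y^-1 of the
   restrictions of phi and of the y-conjugate of psi. *)
Lemma char_conj_sum_ge0 (phi psi : 'CF(H)) (y : gT) :
    phi \is a character -> psi \is a character ->
  0 <= \sum_(x in H) phi x * (psi (x ^ y)%g)^*.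
Proof.
move=> Nphi Npsi; pose K := (H :&: H :^ y^-1)%G.
have sKH : K \subset H by apply: subsetIl.
have sKyH : (conjgm K y @* K)%g \subset H.
  rewrite morphim_conj setIid; apply/subsetP=> _ /imsetP[x + ->].
  by rewrite inE mem_conjgV => /andP[].
pose theta := cfMorph ('Res[(conjgm K y @* K)%g] psi).
have Ntheta : theta \is a character by rewrite cfMorph_char ?cfRes_char.
suff -> : \sum_(x in H) phi x * (psi (x ^ y)%g)^*
            = #|K|%:R * '['Res[K] phi, theta].
  by rewrite mulr_ge0 ?ler0n ?natr_ge0 ?Cnat_cfdot_char ?cfRes_char.
rewrite cfdotE mulVKf ?neq0CG // [RHS]big_mkcond [LHS]big_mkcond /=.
apply: eq_bigr => x _; rewrite inE mem_conjgV.
case: ifP => // Hx; case: ifPn => [Hxy | /cfun0->]; last by rewrite conjC0 mulr0.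
have Kx : x \in K by rewrite !inE Hx mem_conjgV.
by rewrite cfResE // cfMorphE // cfResE // mem_morphim.
Qed.

(** Each summand over [y] is nonnegative, and the one at [g] collapses to its term at [x = 1], a
    product of two positive degrees. *)
Lemma cfdot_Res_Ind_gt0 (phi psi : 'CF(H)) (g : gT) :
    H \subset G -> g \in G -> {in H, forall x, (x ^ g)%g \in H -> x = 1%g} ->
    phi \is a character -> psi \is a character -> phi != 0 -> psi != 0 ->
  0 < '[phi, 'Res[H] ('Ind[G] psi)].
Proof.
move=> sHG Gg tiHg Nphi Npsi nz_phi nz_psi.
rewrite cfdot_Res_Ind // mulr_gt0 ?exprn_gt0 ?invr_gt0 ?gt0CG //.
rewrite (bigD1 g) //= ltr_pwDl //; last first.
  by apply: sumr_ge0 => y _; apply: char_conj_sum_ge0.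
rewrite (bigD1 1%g) //= big1 ?addr0 => [|x /andP[Hx nt_x]].
  by rewrite conj1g conj_natr ?Cnat_char1 // mulr_gt0 ?char1_gt0.
rewrite (cfun0 psi) ?conjC0 ?mulr0 //.
by apply: contra nt_x => /(tiHg x Hx)->.
Qed.

Lemma inclusion_mx_nat i j : inclusion_mx H G i j \in Num.nat.
Proof. by rewrite mxE Cnat_cfdot_char ?cfRes_char ?irr_char. Qed.

Lemma inclusion_mx_mul_tr i j :
  (inclusion_mx H G *m (inclusion_mx H G)^T) i j
    = '['chi_i, 'Res[H] ('Ind[G] 'chi_j)].
Proof.
rewrite Frobenius_reciprocity cfdot_sum_irr mxE; apply: eq_bigr => k _.
rewrite -!Frobenius_reciprocity -[_^*]conjCK !mxE.
by congr (_ * _); rewrite conjCK conj_natr ?Cnat_cfdot_char ?cfRes_char ?irr_char.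
Qed.

End Mackey.

Lemma ler_mx_scale (m n : nat) (A B : 'M[algC]_(m, n)) :
    (forall i j, A i j \in Num.nat) -> (forall i j, 1 <= B i j) ->
  exists2 q : nat, (0 < q)%N & forall i j, A i j <= q%:R * B i j.
Proof.
move=> natA B_ge1; pose a i j := Num.truncn (A i j).
(* The sum of all entries bounds each of them; the successor keeps [q] positive. *)
exists (\sum_i \sum_j a i j).+1 => // i j.
apply: le_trans (ler_peMr _ (B_ge1 i j)); last exact: ler0n.
rewrite -(eqP (etrans (esym (natrEtruncn _)) (natA i j))) ler_nat.
by rewrite leqW // (bigD1 i) //= (bigD1 j) //= -addnA leq_addr.
Qed.

Lemma depth3_of_trivial_conj_inter (gT : finGroupType) (H G : {group gT}) (g : gT) :
    H \subset G -> H :!=: 1%g -> g \in G ->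
    {in H, forall x, (x ^ g)%g \in H -> x = 1%g} ->
  group_algebra_depth H G 3.
Proof.
move=> sHG ntH Gg tiHg; set M := inclusion_mx H G.
have natM i j : M i j \in Num.nat by apply: inclusion_mx_nat.
have nat_mul m n p (A : 'M[algC]_(m, n)) (B : 'M_(n, p)) :
    (forall i j, A i j \in Num.nat) -> (forall i j, B i j \in Num.nat) ->
  forall i j, (A *m B) i j \in Num.nat.
  by move=> natA natB i j; rewrite mxE rpred_sum // => k _; rewrite rpredM.
have natMM : forall i j, (M *m M^T) i j \in Num.nat.
  by apply: nat_mul => // i j; rewrite mxE.
have MM_gt0 i j : 0 < (M *m M^T) i j.
  rewrite inclusion_mx_mul_tr (cfdot_Res_Ind_gt0 sHG Gg) ?irr_char ?irr_neq0 //.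
split=> //.
  rewrite /depth_inequality /= !mulmx1; apply: ler_mx_scale.
    exact: nat_mul.
  move=> i j; have := MM_gt0 i j; have /natrP[k ->] := natMM i j.
  by rewrite ltr0n ler1n.
move=> [|[|[|k]]] // _ [q _ leM]; exfalso.
have [i nz_i] := has_nonprincipal_irr ntH.
(* Column 0 of [M] is a unit vector, so column 0 of [M *m M^T *m M] is column 0 of [M *m M^T]:
   positive at [i], where [M] has a zero. *)
have MiO k : M k 0 = (k == 0)%:R.
  by rewrite mxE !irr0 cfRes_cfun1 -irr0 cfdot_irr.
have /lt_geF/negP[] : 0 < (M *m M^T *m M) i 0.
  rewrite mxE (bigD1 0) //= big1 => [|k nz_k]; last first.
    by rewrite MiO (negPf nz_k) mulr0.
  by rewrite addr0 MiO mulr1.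
by have := leM i 0; rewrite /= MiO (negPf nz_i) mulr0.
Qed.

(** * Rotations and reflections modulo [n] *)

(* For c, x, y < n these say y = x + c and y = c - x modulo n; writing out the
   wrap-around avoids %% and keeps the reasoning in linear arithmetic. *)
Definition rot_rel (n c x y : nat) := (y = x + c \/ y + n = x + c)%N.

Definition refl_rel (n c x y : nat) := (y + x = c \/ y + x = c + n)%N.

Definition dihedral_like n (s : 'I_n -> 'I_n) :=
  exists2 c : nat, (c < n)%N &
    (forall x : 'I_n, rot_rel n c x (s x)) \/ (forall x : 'I_n, refl_rel n c x (s x)).

Lemma dihedral_like_mulg n (s t : 'S_n) :
  dihedral_like s -> dihedral_like t -> dihedral_like (s * t)%g.
Proof.
move=> [c lt_cn [] sE] [d lt_dn [] tE].
(* Since [s] acts first, the new constant modulo [n] is [c + d] if [t] is a rotation and [d - c] if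
   [t] is a reflection. *)
- exists (if c + d < n then c + d else c + d - n)%N; [by case: ifP; lia | left => x].
  rewrite permM; move: (sE x) (tE (s x)) (ltn_ord x) (ltn_ord (t (s x))).
  by case: ifP; rewrite /rot_rel /refl_rel; lia.
- exists (if c <= d then d - c else d + n - c)%N; [by case: ifP; lia | right => x].
  rewrite permM; move: (sE x) (tE (s x)) (ltn_ord x) (ltn_ord (t (s x))).
  by case: ifP; rewrite /rot_rel /refl_rel; lia.
- exists (if c + d < n then c + d else c + d - n)%N; [by case: ifP; lia | right => x].
  rewrite permM; move: (sE x) (tE (s x)) (ltn_ord x) (ltn_ord (t (s x))).
  by case: ifP; rewrite /rot_rel /refl_rel; lia.
- exists (if c <= d then d - c else d + n - c)%N; [by case: ifP; lia | left => x].
  rewrite permM; move: (sE x) (tE (s x)) (ltn_ord x) (ltn_ord (t (s x))).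
  by case: ifP; rewrite /rot_rel /refl_rel; lia.
Qed.

(** Fixing 0 forces [c = 0], and negation modulo [n] moves 1 when [n > 2]. *)
Lemma dihedral_like_id n (s : 'I_n -> 'I_n) (x y : 'I_n) : (2 < n)%N ->
  dihedral_like s -> x = 0%N :> nat -> y = 1%N :> nat -> s x = x -> s y = y ->
  s =1 id.
Proof.
move=> n_gt2 [c lt_cn [] sE] x0 y1 sx sy z; apply: ord_inj;
  move: (sE x) (sE y) (sE z) (ltn_ord z) (ltn_ord (s z));
  rewrite sx sy x0 y1 /rot_rel /refl_rel; lia.
Qed.

(** An arbitrary duplicate-free list of indices makes induction possible. *)
Lemma prod_tperm_rev_ord n (r : seq 'I_n) (x : 'I_n) :
    uniq r ->
  (\prod_(i <- r | (i < n./2)%N) tperm i (rev_ord i))%g x =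
    if (x \in r) && (x < n./2)%N
       || (rev_ord x \in r) && (rev_ord x < n./2)%N
    then rev_ord x else x.
Proof.
elim: r x => [|i r IHr] x; first by rewrite big_nil perm1.
case/andP=> r'i uniq_r; rewrite big_cons !inE.
case: ifPn => [lt_i | ge_i]; last first.
  rewrite IHr //; congr (if _ || _ then _ else _).
    by case: eqP => // ->; rewrite (negPf ge_i) !andbF.
  by case: eqP => // ->; rewrite (negPf ge_i) !andbF.
(* The transpositions are disjoint: no later factor moves [i] or [rev_ord i]. *)
have rev_i : (rev_ord i < n./2)%N = false.
  by move: lt_i; rewrite /=; have := ltn_ord i; lia.
rewrite permM; case: tpermP => [-> | -> | /eqP x'i /eqP x'ri].
- by rewrite IHr // rev_i rev_ordK (negPf r'i) eqxx lt_i !andbF.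
- by rewrite IHr // rev_i (negPf r'i) rev_ordK eqxx lt_i /= andbF orbT.
- by rewrite IHr // (negPf x'i) -(inj_eq rev_ord_inj) rev_ordK (negPf x'ri).
Qed.

Lemma dihedral_reflE n (x : 'I_n) : dihedral_refl n x = rev_ord x.
Proof.
rewrite /dihedral_refl prod_tperm_rev_ord ?index_enum_uniq // !mem_index_enum /=.
(* In the remaining case [x] is the midpoint, which [rev_ord] fixes. *)
by case: ifP => // ltxn; apply: val_inj => /=; have := ltn_ord x; lia.
Qed.

Lemma dihedral_subgroupP n (s : 'S_n) : (1 < n)%N ->
  s \in dihedral_subgroup n -> dihedral_like s.
Proof.
move=> n_gt1 /gen_prodgP[m [c Dc ->]].
elim/big_ind: _ => [|s' t|i _]; last case/set2P: (Dc i) => ->.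
- by exists 0%N; [lia | left=> x; rewrite perm1 /rot_rel; lia].
- exact: dihedral_like_mulg.
- exists 1%N => //; left=> x; rewrite permE /rot_rel /=.
  have := ltn_ord x; case: (ltnP x.+1 n) => [lt_xn | ge_xn] _.
    by rewrite modn_small //; lia.
  have -> : x.+1 = n by have := ltn_ord x; lia.
  by rewrite modnn; have := ltn_ord x; lia.
- exists n.-1; [lia | right=> x].
  by rewrite dihedral_reflE /refl_rel /=; have := ltn_ord x; lia.
Qed.

(** * Arcs of the [n]-gon and the 3-cycle *)

Definition cycle3_rel (x y : nat) :=
  (x = 0 /\ y = 1 \/ x = 1 /\ y = 2 \/ x = 2 /\ y = 0 \/ 2 < x /\ y = x)%N.

Definition cyc_step (n x y : nat) := (y = x.+1 \/ x.+1 = n /\ y = 0)%N.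

Lemma rot_cyc_step (n c x y z : nat) : (x.+1 < n)%N -> (y < n)%N -> (z < n)%N ->
  rot_rel n c x y -> rot_rel n c x.+1 z -> cyc_step n y z.
Proof. by rewrite /rot_rel /cyc_step; lia. Qed.

Lemma refl_cyc_step (n c x y z : nat) : (x.+1 < n)%N -> (y < n)%N -> (z < n)%N ->
  refl_rel n c x y -> refl_rel n c x.+1 z -> cyc_step n z y.
Proof. by rewrite /refl_rel /cyc_step; lia. Qed.

Definition cyc_path (n x y z : nat) :=
  cyc_step n x y /\ cyc_step n y z \/ cyc_step n y x /\ cyc_step n z y.

Lemma dihedral_like_cyc_path n (s : 'I_n -> 'I_n) (x y z : 'I_n) :
    dihedral_like s -> y = x.+1 :> nat -> z = y.+1 :> nat ->
  cyc_path n (s x) (s y) (s z).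
Proof.
move=> [c _ sE] yE zE.
have lt_xy : (x.+1 < n)%N by rewrite -yE.
have lt_yz : (y.+1 < n)%N by rewrite -zE.
case: sE => sE; [left | right]; split.
- by apply: (@rot_cyc_step n c x); rewrite -?yE ?ltn_ord //; apply: sE.
- by apply: (@rot_cyc_step n c y); rewrite -?zE ?ltn_ord //; apply: sE.
- by apply: (@refl_cyc_step n c x); rewrite -?yE ?ltn_ord //; apply: sE.
- by apply: (@refl_cyc_step n c y); rewrite -?zE ?ltn_ord //; apply: sE.
Qed.

(** The 3-cycle maps the arc of the [s] values onto that of the [t] values. As [n > 5], an arc
    meeting {0, 1, 2} only partly has no arc as image (for [n = 5], 2, 3, 4 would give 3, 4, 0). An
    arc disjoint from it is fixed pointwise, but [s1] and [s0] cannot both be its middle. On {0, 1,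
    2} the reversed order fails. *)
Lemma cycle3_rigid (n s0 s1 s2 t0 t1 t2 : nat) :
    (5 < n)%N ->
    cycle3_rel s0 t1 -> cycle3_rel s1 t2 -> cycle3_rel s2 t0 ->
    cyc_path n s0 s1 s2 -> cyc_path n t0 t1 t2 ->
  s0 = 0%N /\ s1 = 1%N.
Proof.
rewrite /cycle3_rel /cyc_path /cyc_step => n_gt5 s0t1 s1t2 s2t0 sE tE.
case: s0t1 => [[? ?]|[[? ?]|[[? ?]|[? ?]]]]; subst;
  case: s1t2 => [[? ?]|[[? ?]|[[? ?]|[? ?]]]]; subst;
  try (exfalso; clear -n_gt5 sE; lia);
  case: s2t0 => [[? ?]|[[? ?]|[[? ?]|[? ?]]]]; subst; lia.
Qed.

Theorem propositionB2 (n : nat) (hn : (5 < n)%N) :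
  group_algebra_depth (dihedral_subgroup n) [set: 'S_n]%G 3.
Proof.
have lt0n : (0 < n)%N by lia.
have lt1n : (1 < n)%N by lia.
have lt2n : (2 < n)%N by lia.
pose o0 := Ordinal lt0n; pose o1 := Ordinal lt1n; pose o2 := Ordinal lt2n.
pose g := (tperm o0 o1 * tperm o0 o2)%g.
apply: (@depth3_of_trivial_conj_inter _ _ _ g) => //.
- exact: subsetT.
- apply/trivgPn; exists (dihedral_rot n).
    by rewrite mem_gen // !inE eqxx.
  apply/eqP=> /permP/(_ o0)/(congr1 val); rewrite permE perm1 /=.
  by rewrite modn_small.
- by rewrite inE.
have gE (x : 'I_n) : cycle3_rel x (g x).
  rewrite permM; case: (tpermP o0 o1 x) => [->|->|x0 x1].
  - by rewrite tpermD //; left.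
  - by rewrite tpermL; right; left.
  case: (tpermP o0 o2 x) => [//|->|_ x2]; first by right; right; left.
  right; right; right; split=> //.
  by move/eqP: x0; move/eqP: x1; move/eqP: x2; rewrite -!val_eqE /=; lia.
have g0 : g o0 = o1 by rewrite permM tpermL tpermD.
have g1 : g o1 = o2 by rewrite permM tpermR tpermL.
have g2 : g o2 = o0 by rewrite permM [tperm _ _ o2]tpermD ?tpermR.
move=> s /(dihedral_subgroupP lt1n) Ds /(dihedral_subgroupP lt1n) Dt.
have [s0 s1] : s o0 = 0%N :> nat /\ s o1 = 1%N :> nat.
  (* The conjugate [s ^ g] sends [g x] to [g (s x)], which shifts the indices of the [t] values by
     one. *)
  have sg x : cycle3_rel (s x) ((s ^ g)%g (g x)) by rewrite permJ.
  have := sg o0; have := sg o1; have := sg o2; rewrite g0 g1 g2 => sg2 sg1 sg0.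
  by apply: (cycle3_rigid hn sg0 sg1 sg2); apply: dihedral_like_cyc_path.
apply/permP=> x; rewrite perm1.
by apply: (dihedral_like_id (x := o0) (y := o1) lt2n Ds) => //; apply: ord_inj.
Qed.
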